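(* Let $n,k\ge 1$ and $N\ge 1$ be integers, let $C=-(A-\lambda dd^{\top})\in\mathbb{R}^{n\times n}$, where $A\in\{0,1\}^{n\times n}$ is a symmetric matrix with zero diagonal, $d\in\mathbb{R}^n$ is given by $d_i=\sum_j A_{ij}$, and $\lambda\in\mathbb{R}$ is a fixed parameter. Let $\sigma>0$, and let $U^0,U^1,\dots,U^N\in\mathbb{R}^{n\times k}$ be a sequence generated by the proximal row-by-row (RBR) algorithm (described in the context, with $p=k$) with proximal parameter $\sigma$, started from a feasible point $U^0$. Let $$t^*:=\arg\min_{1\le t\le N}\left\{\|U^{t-1}-U^t\|_F^2\right\}.$$ Then there exist $\lambda_i\in\mathbb{R}$ and $v_i\in\mathbb{R}^k_+$, $i=1,\dots,n$, such that, with $\Lambda=\mathrm{diag}\{\lambda_1,\dots,\lambda_n\}$ and $V=(v_1,\dots,v_n)^{\top}\in\mathbb{R}^{n\times k}$, $$\begin{cases}\left\|2CU^{t^*}+2\Lambda U^{t^*}-V\right\|_F\le 2\sqrt{\dfrac{2\|C\|_1\left(4\|C\|_F^2+\sigma^2\right)}{N\sigma}},\\[2mm] \|u_i^{t^*}\|=1,\quad u_i^{t^*}\ge 0,\quad v_i\ge 0, & i=1,\dots,n,\\ (u_i^{t^*})_j(v_i)_j=0, & i=1,\dots,n,\ j=1,\dots,k,\end{cases}$$ where $(u_i^{t^*})^{\top}$ denotes the $i$th row of $U^{t^*}$.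
   Context: $\|\cdot\|$ is the Euclidean norm, $\|\cdot\|_F$ the Frobenius norm, and $\|C\|_1=\sum_{i,j}|C_{ij}|$ is the component-wise $\ell_1$ norm. Inequalities between vectors are component-wise, and $\mathbb{R}^k_+$ is the nonnegative orthant. For a matrix $U\in\mathbb{R}^{n\times k}$ write $U=(u_1,\dots,u_n)^{\top}$ with $u_i\in\mathbb{R}^k$, and put $f(U)=f(u_1,\dots,u_n)=\langle C,UU^{\top}\rangle$, where $\langle X,Y\rangle=\mathrm{Tr}(X^{\top}Y)$. The problem considered (case $p=k$, in which the row-sparsity constraint is vacuous) is: minimize $f(U)$ subject to $u_i\in\mathcal{U}_i:=\{x\in\mathbb{R}^k:\|x\|=1,\ x\ge 0\}$ for $i=1,\dots,n$. A point $U$ is feasible if all its rows satisfy $u_i\in\mathcal{U}_i$. RBR algorithm: given $U^0$ and $\sigma>0$, for $t=0,1,2,\dots$ and, within each $t$, for $i=1,\dots,n$ in order, choose $$u_i^{t+1}\in\arg\min_{x\in\mathcal{U}_i}\ f(u_1^{t+1},\dots,u_{i-1}^{t+1},x,u_{i+1}^{t},\dots,u_n^{t})+\frac{\sigma}{2}\|x-u_i^t\|^2,$$ and set $U^{t+1}=(u_1^{t+1},\dots,u_n^{t+1})^{\top}$. *)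

(* Defs.v *)
From HB Require Import structures.
From mathcomp Require Import all_boot all_order all_algebra.
From mathcomp Require Import reals.

Set Implicit Arguments.
Unset Strict Implicit.
Unset Printing Implicit Defensive.

Import Order.TTheory GRing.Theory Num.Theory.

Local Open Scope ring_scope.

Section Norms.
Context {R : realType}.

(* These are spelled out because the generic norm that MathComp-Analysis puts
   on matrices is the sup norm, not the Euclidean/Frobenius one. *)
Definition norm2 k (x : 'rV[R]_k) : R := Num.sqrt (\sum_(j < k) x 0 j ^+ 2).

Definition normF m n (X : 'M[R]_(m, n)) : R :=
  Num.sqrt (\sum_(i < m) \sum_(j < n) X i j ^+ 2).

Definition norm1 m n (X : 'M[R]_(m, n)) : R :=
  \sum_(i < m) \sum_(j < n) `|X i j|.

Definition mxinner m n (X Y : 'M[R]_(m, n)) : R := \tr (X^T *m Y).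

Definition nonneg k (x : 'rV[R]_k) : Prop := forall j, 0 <= x 0 j.

Definition is_argmin (T : Type) (S : T -> Prop) (g : T -> R) (x : T) : Prop :=
  S x /\ forall y, S y -> g x <= g y.

End Norms.

Section Problem.
Context {R : realType}.

Definition degree_vec n (A : 'M[R]_n) : 'cV[R]_n :=
  \col_(i < n) \sum_(j < n) A i j.

Definition cost_mx n (A : 'M[R]_n) (lambda : R) : 'M[R]_n :=
  - (A - lambda *: (degree_vec A *m (degree_vec A)^T)).

Definition objective n k (C : 'M[R]_n) (U : 'M[R]_(n, k)) : R :=
  mxinner C (U *m U^T).

Definition in_sphere_orthant k (x : 'rV[R]_k) : Prop :=
  norm2 x = 1 /\ nonneg x.

Definition feasible n k (U : 'M[R]_(n, k)) : Prop :=
  forall i, in_sphere_orthant (row i U).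

(* Rows before [i] come from the new iterate, row [i] is [x], and rows after
   [i] come from the old iterate. *)
Definition rbr_mix n k (Unew Uold : 'M[R]_(n, k)) (i : 'I_n) (x : 'rV[R]_k) :
    'M[R]_(n, k) :=
  \matrix_(j < n) (if (j < i)%N then row j Unew
                   else if j == i then x else row j Uold).

(* Row [i] of [rbr_mix Unew Uold i x] is [x] and only rows before [i] of [Unew]
   are used, so imposing the condition for all [i] at once is the sequential
   sweep over i. The minimizers need not be unique. *)
Definition rbr_sweep n k (C : 'M[R]_n) (sigma : R) (Uold Unew : 'M[R]_(n, k)) :
    Prop :=
  forall i : 'I_n,
    is_argmin (@in_sphere_orthant k)
      (fun x => objective C (rbr_mix Unew Uold i x)
                + sigma / 2 * norm2 (x - row i Uold) ^+ 2)
      (row i Unew).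

Definition rbr_sequence n k (C : 'M[R]_n) (sigma : R) (N : nat)
    (U : nat -> 'M[R]_(n, k)) : Prop :=
  forall t, (t < N)%N -> rbr_sweep C sigma (U t) (U t.+1).

End Problem.

(* Main.v *)
Require Import Defs.
From HB Require Import structures.
From mathcomp Require Import all_boot all_order all_algebra.
From mathcomp Require Import reals.
From mathcomp Require Import ring lra.

(** The distance between consecutive iterates controls both the decrease of the
    objective and the violation of the optimality conditions.

    On the unit sphere the diagonal term of the objective and the proximal term
    are respectively constant and linear, so each row update minimizes a linear
    form over the nonnegative unit vectors ([sweep_linear_argmin]). Its minimizers
    satisfy exact first-order conditions with a multiplier for the sphere and a
    nonnegative complementary vector for the orthant ([argmin_kkt]). Collected
    over the rows, these are the wanted conditions, except that row [i] was
    updated against the old values of the later rows and with a proximal term.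
    With [D = Unew - Uold] and [L] the strictly upper triangular part of [C], the
    residual is exactly [2 L D - sigma D] ([sweep_residual]), so its squared norm
    is at most [2 (4 |C|_F^2 + sigma^2) |D|_F^2] ([sqr_normF_residual]).

    On the other hand a sweep decreases the objective by at least
    [sigma / 2 * |D|_F^2] ([sweep_descent]), while the objective of a feasible
    point is at most [|C|_1] in absolute value ([objective_bound]). Hence the sum
    of the [N] squared steps is at most [4 |C|_1 / sigma], and the smallest is at
    most [4 |C|_1 / (N sigma)] ([rbr_min_step]). The two estimates multiply to
    the square of the claimed bound. *)

Set Implicit Arguments.
Unset Strict Implicit.
Unset Printing Implicit Defensive.

Import Order.TTheory GRing.Theory Num.Theory.

Local Open Scope ring_scope.

Section RowByRow.
Context {R : realType}.

(** * Inner products and Euclidean norms *)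

Definition dotr k (x y : 'rV[R]_k) : R := \sum_j x 0 j * y 0 j.

Lemma dotrC k (x y : 'rV[R]_k) : dotr x y = dotr y x.
Proof. by apply: eq_bigr => j _; rewrite mulrC. Qed.

Lemma dotrDr k (x y z : 'rV[R]_k) : dotr x (y + z) = dotr x y + dotr x z.
Proof. by rewrite -big_split; apply: eq_bigr => j _; rewrite mxE mulrDr. Qed.

Lemma dotrZr k (x y : 'rV[R]_k) a : dotr x (a *: y) = a * dotr x y.
Proof. by rewrite mulr_sumr; apply: eq_bigr => j _; rewrite mxE mulrCA. Qed.

Lemma dotrBr k (x y z : 'rV[R]_k) : dotr x (y - z) = dotr x y - dotr x z.
Proof. by rewrite -(scaleN1r z) dotrDr dotrZr mulN1r. Qed.

Lemma dotr_sumr k (x : 'rV[R]_k) (I : finType) (P : pred I) (F : I -> 'rV[R]_k) :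
  dotr x (\sum_(i | P i) F i) = \sum_(i | P i) dotr x (F i).
Proof.
rewrite exchange_big; apply: eq_bigr => j _.
by rewrite summxE mulr_sumr.
Qed.

Lemma dotr_delta k (x : 'rV[R]_k) j : dotr x (delta_mx 0 j) = x 0 j.
Proof.
rewrite /dotr (bigD1 j) //= mxE !eqxx mulr1 big1 ?addr0 // => i ij.
by rewrite mxE (negPf ij) andbF mulr0.
Qed.

Lemma sqr_norm2 k (x : 'rV[R]_k) : norm2 x ^+ 2 = dotr x x.
Proof. by rewrite sqr_sqrtr // sumr_ge0 // => j _; exact: sqr_ge0. Qed.

Lemma sqr_norm2B k (x y : 'rV[R]_k) :
  norm2 (x - y) ^+ 2 = dotr x x - 2 * dotr x y + dotr y y.
Proof.
rewrite sqr_norm2 dotrBr ![dotr (x - y) _]dotrC !dotrBr (dotrC y x); ring.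
Qed.

Lemma norm2_ge0 k (x : 'rV[R]_k) : 0 <= norm2 x.
Proof. exact: sqrtr_ge0. Qed.

Lemma sqr_normF m n (X : 'M[R]_(m, n)) :
  normF X ^+ 2 = \sum_i \sum_j X i j ^+ 2.
Proof.
rewrite sqr_sqrtr // !sumr_ge0 // => i _.
by rewrite sumr_ge0 // => j _; exact: sqr_ge0.
Qed.

Lemma sqr_normF_rows m n (X : 'M[R]_(m, n)) :
  normF X ^+ 2 = \sum_i norm2 (row i X) ^+ 2.
Proof.
rewrite sqr_normF; apply: eq_bigr => i _.
by rewrite sqr_norm2; apply: eq_bigr => j _; rewrite mxE.
Qed.

Lemma sqr_normFZ m n a (X : 'M[R]_(m, n)) : normF (a *: X) ^+ 2 = a ^+ 2 * normF X ^+ 2.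
Proof.
rewrite !sqr_normF mulr_sumr; apply: eq_bigr => i _; rewrite mulr_sumr.
by apply: eq_bigr => j _; rewrite mxE exprMn.
Qed.

Lemma sqr_normFB_le m n (X Y : 'M[R]_(m, n)) :
  normF (X - Y) ^+ 2 <= 2 * (normF X ^+ 2 + normF Y ^+ 2).
Proof.
rewrite !sqr_normF -big_split mulr_sumr ler_sum // => i _.
rewrite -big_split mulr_sumr ler_sum // => j _; rewrite /= !mxE.
have := sqr_ge0 (X i j + Y i j); lra.
Qed.

(** Lagrange's identity: the difference of the two sides is half the sum of all
    the squares [(a i * b j - a j * b i) ^+ 2]. *)
Lemma Cauchy_Schwarz_sum (I : finType) (a b : I -> R) :
  (\sum_i a i * b i) ^+ 2 <= (\sum_i a i ^+ 2) * (\sum_i b i ^+ 2).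
Proof.
have : 0 <= \sum_i \sum_j (a i * b j - a j * b i) ^+ 2.
  by apply: sumr_ge0 => i _; apply: sumr_ge0 => j _; exact: sqr_ge0.
have -> : \sum_i \sum_j (a i * b j - a j * b i) ^+ 2
   = 2 * ((\sum_i a i ^+ 2) * (\sum_i b i ^+ 2)) - 2 * (\sum_i a i * b i) ^+ 2.
  transitivity (\sum_i \sum_j (a i ^+ 2 * b j ^+ 2) + \sum_i \sum_j (b i ^+ 2 * a j ^+ 2)
     - 2 * \sum_i \sum_j (a i * b i) * (a j * b j)).
    rewrite mulr_sumr -big_split -sumrB /=; apply: eq_bigr => i _.
    rewrite mulr_sumr -big_split -sumrB /=; apply: eq_bigr => j _; ring.
  by rewrite -!big_distrlr /=; ring.
lra.
Qed.

Lemma sqr_normFM_le m n p (X : 'M[R]_(m, n)) (Y : 'M[R]_(n, p)) :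
  normF (X *m Y) ^+ 2 <= normF X ^+ 2 * normF Y ^+ 2.
Proof.
rewrite !sqr_normF mulr_suml ler_sum // => i _.
rewrite [X in _ <= _ * X]exchange_big mulr_sumr ler_sum // => l _.
by rewrite mxE; exact: Cauchy_Schwarz_sum.
Qed.

Lemma dotr_unit_le1 k (x y : 'rV[R]_k) :
  norm2 x = 1 -> norm2 y = 1 -> `|dotr x y| <= 1.
Proof.
move=> x1 y1; rewrite -(ler_pXn2r (n := 2)) ?nnegrE // expr1n real_normK ?num_real //.
apply: (le_trans (Cauchy_Schwarz_sum _ _)).
have sq (z : 'rV[R]_k) : \sum_i z 0 i ^+ 2 = norm2 z ^+ 2.
  by rewrite sqr_norm2; apply: eq_bigr => j _.
by rewrite !sq x1 y1 !expr1n mulr1.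
Qed.

(** * First-order optimality on the nonnegative part of the sphere *)

(** A linear form is homogeneous, so its minimality over unit vectors of the
    orthant extends to the whole orthant by rescaling [y] to norm 1. This turns
    the nonconvex constraint into comparisons along arbitrary nonnegative
    directions. *)
Lemma argmin_homogeneous k (g x : 'rV[R]_k) :
  is_argmin (@in_sphere_orthant R k) (dotr g) x ->
  forall y, nonneg y -> dotr g x * norm2 y <= dotr g y.
Proof.
move=> [_ xmin] y y0.
have := norm2_ge0 y; rewrite le_eqVlt => /orP[/eqP n0|ngt0].
  suff -> : y = 0.
    rewrite /norm2 [X in Num.sqrt X]big1; last by move=> j _; rewrite mxE expr0n.
    by rewrite sqrtr0 mulr0 /dotr big1 // => j _; rewrite mxE mulr0.
  apply/rowP => j; rewrite mxE.
  have := sqr_norm2 y; rewrite -n0 expr0n /= => /esym/eqP.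
  rewrite psumr_eq0; last by move=> i _; exact: sqr_ge0.
  by move/allP/(_ j (mem_index_enum j)); rewrite mulf_eq0 orbb => /eqP.
have zS : in_sphere_orthant ((norm2 y)^-1 *: y).
  split; last by move=> j; rewrite mxE mulr_ge0 // invr_ge0 ltW.
  apply/eqP; rewrite -(eqrXn2 (n := 2)) ?norm2_ge0 // sqr_norm2.
  by rewrite dotrZr dotrC dotrZr -sqr_norm2 expr1n; apply/eqP; field; rewrite gt_eqF.
by have := xmin _ zS; rewrite dotrZr mulrC ler_pdivlMr.
Qed.

(** The Lagrange multiplier of the sphere constraint is the optimal value
    [m = dotr g x] with its sign changed. Only perturbations [x + s *: e_j] with
    [s >= 0] are needed: they stay in the orthant, and to first order
    [norm2 (x + s *: e_j)] is [1 + s * x 0 j], which gives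
    [m * x 0 j <= g 0 j]. Complementarity is then free, because
    [dotr x v = m - m * norm2 x ^+ 2 = 0] is a sum of nonnegative terms. *)
Lemma argmin_kkt k (g x : 'rV[R]_k) :
  is_argmin (@in_sphere_orthant R k) (dotr g) x ->
  let v := g - dotr g x *: x in nonneg v /\ forall j, x 0 j * v 0 j = 0.
Proof.
move=> xmin v; set m := dotr g x in v *.
have [[x1 x0] _] := xmin.
have dx1 : dotr x x = 1 by rewrite -sqr_norm2 x1 expr1n.
have v0 : nonneg v.
  move=> j; rewrite !mxE.
  have xj1 : x 0 j <= 1.
    rewrite -(ler_pXn2r (n := 2)) ?nnegrE // expr1n -dx1 /dotr (bigD1 j) //= expr2.
    by rewrite lerDl sumr_ge0 // => i _; exact: sqr_ge0.
  have step s : 0 <= s -> exists2 N, m * N <= m + s * g 0 j &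
      0 <= N /\ N ^+ 2 = 1 + 2 * s * x 0 j + s ^+ 2.
    move=> s0; exists (norm2 (x + s *: delta_mx 0 j)).
      rewrite (le_trans (argmin_homogeneous xmin _)) //.
        move=> i; rewrite !mxE addr_ge0 // mulr_ge0 // ler0n //.
      by rewrite dotrDr dotrZr dotr_delta.
    split; first exact: norm2_ge0.
    rewrite sqr_norm2 dotrDr ![dotr (_ + _) _]dotrC !dotrDr ![dotr _ (s *: _)]dotrZr dx1.
    rewrite ![dotr (s *: _) _]dotrC !dotrZr !dotr_delta !mxE !eqxx /=; ring.
  have xj0 := x0 j.
  have [m0|m0] := leP 0 m.
    (* The norm is at least 1 + s x_j because x_j <= 1, so no limit is needed:
       s = 1 will do. *)
    have [N mN [N0 NE]] := step 1 ler01.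
    have : 1 + x 0 j <= N.
      rewrite -(ler_pXn2r (n := 2)) ?nnegrE ?addr_ge0 // NE; nra.
    nra.
  (* For m < 0 the norm has to be bounded above, by 1 + s x_j + s^2 / 2. The
     quadratic term costs |m| s^2 / 2, so s = d / |m| loses only half of the
     violation d. *)
  rewrite leNgt; apply/negP => neg.
  pose d := m * x 0 j - g 0 j.
  have d0 : 0 < d by rewrite /d; lra.
  have s0 : 0 < d / - m by rewrite divr_gt0 // oppr_gt0.
  have [N mN [N0 NE]] := step _ (ltW s0).
  have ms : m * (d / - m) = - d by field; rewrite lt_eqF.
  move: (d / - m) s0 ms mN NE => s s0 ms mN NE.
  have Nle : N <= 1 + s * x 0 j + s ^+ 2 / 2.
    have a0 : 0 <= s * x 0 j by rewrite mulr_ge0 // ltW.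
    rewrite -(ler_pXn2r (n := 2)) ?nnegrE //; last by have := sqr_ge0 s; lra.
    rewrite NE; have := sqr_ge0 (s * x 0 j + s ^+ 2 / 2); nra.
  have := ler_wnM2l (ltW m0) Nle.
  have -> : m * (1 + s * x 0 j + s ^+ 2 / 2)
     = m + s * (m * x 0 j) + (m * s) * s / 2 by ring.
  rewrite ms; have -> : m * x 0 j = d + g 0 j by rewrite /d; ring.
  have : 0 < s * d by rewrite mulr_gt0.
  move: mN; lra.
split=> // j.
have : dotr x v = 0 by rewrite dotrBr dotrZr dx1 mulr1 dotrC subrr.
move/eqP; rewrite psumr_eq0; last by move=> i _; rewrite mulr_ge0.
by move/allP/(_ j (mem_index_enum j))/eqP.
Qed.

(** * The objective as a function of one row *)

Lemma objectiveE n k (C : 'M[R]_n) (U : 'M[R]_(n, k)) :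
  objective C U = \sum_i \sum_j C i j * dotr (row i U) (row j U).
Proof.
rewrite /objective /mxinner /mxtrace exchange_big; apply: eq_bigr => j _.
rewrite mxE; apply: eq_bigr => i _; rewrite !mxE; congr (_ * _).
by apply: eq_bigr => l _; rewrite !mxE.
Qed.

Lemma objective_bound n k (C : 'M[R]_n) (U : 'M[R]_(n, k)) :
  feasible U -> `|objective C U| <= norm1 C.
Proof.
move=> Uf; rewrite objectiveE (le_trans (ler_norm_sum _ _ _)) // ler_sum // => i _.
rewrite (le_trans (ler_norm_sum _ _ _)) // ler_sum // => j _.
rewrite normrM ler_piMr // dotr_unit_le1 //; by case: (Uf i); case: (Uf j).
Qed.

Lemma cost_mx_sym n (A : 'M[R]_n) lambda :
  A^T = A -> (cost_mx A lambda)^T = cost_mx A lambda.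
Proof. by move=> As; rewrite /cost_mx linearN linearB linearZ /= trmx_mul trmxK As. Qed.

(** Half the gradient in row [i] of the objective seen by the update of that
    row, without the diagonal term. *)
Definition coupling n k (C : 'M[R]_n) (Unew Uold : 'M[R]_(n, k)) (i : 'I_n) : 'rV[R]_k :=
  \sum_(j | j != i) C i j *: (if (j < i)%N then row j Unew else row j Uold).

Lemma row_rbr_mix n k (Unew Uold : 'M[R]_(n, k)) (i : 'I_n) x j :
  row j (rbr_mix Unew Uold i x) =
  if (j < i)%N then row j Unew else if j == i then x else row j Uold.
Proof. by rewrite rowK. Qed.

(** The quadratic part [C i i * dotr x x] is constant on the unit sphere, so
    each row subproblem is in effect linear. *)
Lemma objective_rbr_mix n k (C : 'M[R]_n) (Unew Uold : 'M[R]_(n, k)) (i : 'I_n) :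
  C^T = C -> exists c, forall x, objective C (rbr_mix Unew Uold i x) =
    C i i * dotr x x + 2 * dotr (coupling C Unew Uold i) x + c.
Proof.
move=> Csym.
pose w (j : 'I_n) := if (j < i)%N then row j Unew else row j Uold.
exists (\sum_(a | a != i) \sum_(b | b != i) C a b * dotr (w a) (w b)) => x.
have ri : row i (rbr_mix Unew Uold i x) = x by rewrite row_rbr_mix ltnn eqxx.
have rj j : j != i -> row j (rbr_mix Unew Uold i x) = w j.
  by move=> ji; rewrite row_rbr_mix (negPf ji).
have split_row a (r : 'rV[R]_k) :
    \sum_b C a b * dotr r (row b (rbr_mix Unew Uold i x)) =
    C a i * dotr r x + \sum_(b | b != i) C a b * dotr r (w b).
  rewrite (bigD1 i) //= ri; congr (_ + _).
  by apply: eq_bigr => b bi; rewrite rj.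
rewrite objectiveE (bigD1 i) //= ri split_row.
under eq_bigr => a ai do rewrite split_row rj //.
rewrite big_split /= addrA; congr (_ + _).
rewrite -addrA; congr (_ + _); rewrite dotrC dotr_sumr.
have -> : \sum_(a | a != i) C a i * dotr (w a) x = \sum_(a | a != i) C i a * dotr x (w a).
  by apply: eq_bigr => a _; rewrite dotrC -{1}Csym mxE.
rewrite mulr_sumr -big_split; apply: eq_bigr => a _; rewrite dotrZr /w /=; ring.
Qed.

(** * One sweep *)

Lemma sweep_feasible n k (C : 'M[R]_n) sigma (Uold Unew : 'M[R]_(n, k)) :
  rbr_sweep C sigma Uold Unew -> feasible Unew.
Proof. by move=> S i; case: (S i). Qed.

(** For unit vectors the proximal term is linear as well:
    [norm2 (x - u) ^+ 2 = 2 - 2 * dotr x u]. *)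
Lemma sweep_linear_argmin n k (C : 'M[R]_n) sigma (Uold Unew : 'M[R]_(n, k)) i :
  C^T = C -> rbr_sweep C sigma Uold Unew ->
  is_argmin (@in_sphere_orthant R k)
    (dotr (2 *: coupling C Unew Uold i - sigma *: row i Uold)) (row i Unew).
Proof.
move=> Csym S; have [xS xmin] := S i; split=> // y yS.
have [c cE] := objective_rbr_mix Unew Uold i Csym.
have sphere (z : 'rV[R]_k) : in_sphere_orthant z -> dotr z z = 1.
  by move=> [z1 _]; rewrite -sqr_norm2 z1 expr1n.
have := xmin _ yS; rewrite !cE !sqr_norm2B !(sphere _ xS) !(sphere _ yS).
rewrite !(dotrC (2 *: _ - _)) !dotrBr !dotrZr !(dotrC (coupling _ _ _ _)).
lra.
Qed.

(** Comparing each new row with the old one, which is admissible in the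
    subproblem, bounds the loss of objective value in that row update from
    below; the sum over the rows telescopes. *)
Lemma sweep_descent n k (C : 'M[R]_n) sigma (Uold Unew : 'M[R]_(n, k)) :
  feasible Uold -> rbr_sweep C sigma Uold Unew ->
  objective C Unew + sigma / 2 * normF (Uold - Unew) ^+ 2 <= objective C Uold.
Proof.
move=> Uf S.
(* M m is the iterate after the first m row updates. *)
pose M m : 'M[R]_(n, k) := \matrix_(j < n) if (j < m)%N then row j Unew else row j Uold.
pose D i := sigma / 2 * norm2 (row i (Uold - Unew)) ^+ 2.
have step (i : 'I_n) : D i <= - (objective C (M i.+1) - objective C (M i)).
  have [_ /(_ _ (Uf i))] := S i.
  have -> : rbr_mix Unew Uold i (row i Unew) = M i.+1.
    apply/row_matrixP => j; rewrite !rowK ltnS -val_eqE /=.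
    by case: ltngtP => // /ord_inj ->.
  have -> : rbr_mix Unew Uold i (row i Uold) = M i.
    apply/row_matrixP => j; rewrite !rowK.
    by case: ltnP => // _; case: eqP => // ->.
  rewrite !sqr_norm2B /D raddfB /= sqr_norm2B (dotrC (row i Uold) (row i Unew)).
  lra.
have ME : Unew = M n by apply/row_matrixP => j; rewrite rowK ltn_ord.
have M0 : Uold = M 0%N by apply/row_matrixP => j; rewrite rowK.
rewrite sqr_normF_rows mulr_sumr.
have : \sum_i D i <= \sum_(i < n) - (objective C (M i.+1) - objective C (M i)).
  by apply: ler_sum => i _; exact: step.
rewrite sumrN -(big_mkord xpredT (fun i => objective C (M i.+1) - objective C (M i))).
rewrite telescope_sumr // -ME -M0 /D; lra.
Qed.

Definition strict_upper n (C : 'M[R]_n) : 'M[R]_n := \matrix_(i, j) (C i j *+ (i < j)%N).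

Lemma sqr_normF_strict_upper n (C : 'M[R]_n) :
  normF (strict_upper C) ^+ 2 <= normF C ^+ 2.
Proof.
rewrite !sqr_normF ler_sum // => i _; rewrite ler_sum // => j _; rewrite mxE.
by case: (i < j)%N => //=; rewrite expr0n sqr_ge0.
Qed.

Lemma row_mulmx m n k (C : 'M[R]_(m, n)) (U : 'M[R]_(n, k)) i :
  row i (C *m U) = \sum_j C i j *: row j U.
Proof. by rewrite row_mul mulmx_sum_row; apply: eq_bigr => j _; rewrite mxE. Qed.

(** The update of row [i] sees old values exactly in the rows [j > i], so it
    misses the true gradient by the strictly upper triangular part of [C]
    applied to the step. *)
Lemma row_mul_coupling n k (C : 'M[R]_n) (Unew Uold : 'M[R]_(n, k)) i :
  row i (C *m Unew) = coupling C Unew Uold i + C i i *: row i Unew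
    + row i (strict_upper C *m (Unew - Uold)).
Proof.
rewrite !row_mulmx (bigD1 i) //= [X in _ + _ + X](bigD1 i) //=.
rewrite [strict_upper C i i]mxE ltnn scale0r add0r [coupling _ _ _ _ + _]addrC -addrA.
congr (_ + _); rewrite -big_split; apply: eq_bigr => j ji.
rewrite /= [strict_upper C i j]mxE; case: ltngtP => [_|_|/ord_inj/eqP].
- by rewrite scale0r addr0.
- by rewrite -scalerDr raddfB /= addrC subrK.
- by rewrite (negPf ji).
Qed.

(** Optimality of each row problem is the desired optimality system for the
    whole iterate, up to the outdated rows and the proximal term, both of
    which are linear in the step. *)
Lemma sweep_residual n k (C : 'M[R]_n) sigma (Uold Unew : 'M[R]_(n, k)) :
  C^T = C -> rbr_sweep C sigma Uold Unew ->
  exists (l : 'I_n -> R) (v : 'I_n -> 'rV[R]_k),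
    [/\ 2 *: (C *m Unew) + 2 *: (diag_mx (\row_(i < n) l i) *m Unew) - \matrix_(i < n) v i
        = 2 *: (strict_upper C *m (Unew - Uold)) - sigma *: (Unew - Uold),
      forall i, nonneg (v i) & forall i j, row i Unew 0 j * v i 0 j = 0].
Proof.
move=> Csym S.
pose g i := 2 *: coupling C Unew Uold i - sigma *: row i Uold.
pose m i := dotr (g i) (row i Unew).
(* 2 l i is the multiplier -m of the row problem, minus 2 C i i to cancel the
   diagonal term of 2 C U that the linear form lacks, and minus sigma because
   sigma u_old = sigma u_new - sigma (u_new - u_old). *)
exists (fun i => - (m i + sigma) / 2 - C i i), (fun i => g i - m i *: row i Unew).
have kkt i := argmin_kkt (sweep_linear_argmin i Csym S).
split=> [|i|i]; try by have [] := kkt i.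
have := row_mul_coupling C Unew Uold.
move: (C *m Unew) (strict_upper C *m _) => CU E CUE.
apply/matrixP => i j; have /rowP/(_ j) := CUE i.
by rewrite mul_diag_mx !mxE /g => ->; field.
Qed.

Lemma sqr_normF_residual n k (C : 'M[R]_n) sigma (X : 'M[R]_(n, k)) :
  normF (2 *: (strict_upper C *m X) - sigma *: X) ^+ 2
    <= 2 * (4 * normF C ^+ 2 + sigma ^+ 2) * normF X ^+ 2.
Proof.
apply: (le_trans (sqr_normFB_le _ _)); rewrite !sqr_normFZ.
have := sqr_normFM_le (strict_upper C) X.
have := ler_wpM2r (sqr_ge0 (normF X)) (sqr_normF_strict_upper C).
lra.
Qed.

(** * The whole sequence of sweeps *)

Lemma rbr_feasible n k (C : 'M[R]_n) sigma N (U : nat -> 'M[R]_(n, k)) t :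
  feasible (U 0%N) -> rbr_sequence C sigma N U -> (t <= N)%N -> feasible (U t).
Proof. by case: t => // t _ S tN; apply: sweep_feasible (S _ tN). Qed.

(** The steps are paid for by the decrease of the objective, whose values on
    feasible points lie between [- norm1 C] and [norm1 C]. *)
Lemma rbr_sum_steps n k (C : 'M[R]_n) sigma N (U : nat -> 'M[R]_(n, k)) :
  feasible (U 0%N) -> rbr_sequence C sigma N U ->
  sigma * \sum_(t < N) normF (U t - U t.+1) ^+ 2 <= 4 * norm1 C.
Proof.
move=> U0 S.
have step (t : 'I_N) : sigma / 2 * normF (U t - U t.+1) ^+ 2
    <= - (objective C (U t.+1) - objective C (U t)).
  have := sweep_descent (rbr_feasible U0 S (ltnW (ltn_ord t))) (S _ (ltn_ord t)); lra.
have : \sum_(t < N) sigma / 2 * normF (U t - U t.+1) ^+ 2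
    <= \sum_(t < N) - (objective C (U t.+1) - objective C (U t)).
  by apply: ler_sum => t _; exact: step.
rewrite sumrN -(big_mkord xpredT (fun i => objective C (U i.+1) - objective C (U i))).
rewrite telescope_sumr // -mulr_sumr.
have := objective_bound C U0; have := objective_bound C (rbr_feasible U0 S (leqnn N)).
rewrite !ler_norml => /andP[? ?] /andP[? ?]; lra.
Qed.

Lemma rbr_min_step n k (C : 'M[R]_n) sigma N (U : nat -> 'M[R]_(n, k)) t :
  feasible (U 0%N) -> rbr_sequence C sigma N U -> 0 < sigma -> (0 < N)%N ->
  (forall s, (1 <= s <= N)%N -> normF (U t.-1 - U t) ^+ 2 <= normF (U s.-1 - U s) ^+ 2) ->
  normF (U t.-1 - U t) ^+ 2 <= 4 * norm1 C / (N%:R * sigma).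
Proof.
move=> U0 S s0 N0 tmin; rewrite ler_pdivlMr ?mulr_gt0 ?ltr0n //.
apply: le_trans (rbr_sum_steps U0 S).
rewrite mulrA mulrC ler_pM2l // mulr_natr -[N in _ *+ N]card_ord -sumr_const.
apply: ler_sum => s _; exact: (tmin s.+1 (ltn_ord s)).
Qed.

End RowByRow.

Theorem theorem3p2 (R : realType) (n k N : nat)
  (n_ge1 : (1 <= n)%N) (k_ge1 : (1 <= k)%N) (N_ge1 : (1 <= N)%N)
  (A : 'M[R]_n) (lambda sigma : R)
  (A_01 : forall i j, A i j = 0 \/ A i j = 1)
  (A_sym : A^T = A)
  (A_diag0 : forall i, A i i = 0)
  (C : 'M[R]_n) (C_def : C = cost_mx A lambda)
  (sigma_gt0 : 0 < sigma)
  (U : nat -> 'M[R]_(n, k))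
  (U0_feasible : feasible (U 0%N))
  (U_rbr : rbr_sequence C sigma N U)
  (tstar : nat)
  (tstar_argmin : is_argmin (fun t : nat => (1 <= t <= N)%N)
                    (fun t : nat => normF (U t.-1 - U t) ^+ 2) tstar) :
  exists (l : 'I_n -> R) (v : 'I_n -> 'rV[R]_k),
    let Lambda : 'M[R]_n := diag_mx (\row_(i < n) l i) in
    let V : 'M[R]_(n, k) := \matrix_(i < n) v i in
    [/\ normF (2 *: (C *m U tstar) + 2 *: (Lambda *m U tstar) - V)
          <= 2 * Num.sqrt (2 * norm1 C * (4 * normF C ^+ 2 + sigma ^+ 2)
                           / (N%:R * sigma)),
        forall i, [/\ norm2 (row i (U tstar)) = 1,
                      nonneg (row i (U tstar)) & nonneg (v i)]
      & forall i j, row i (U tstar) 0 j * v i 0 j = 0].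
Proof.
have Csym : C^T = C by rewrite C_def cost_mx_sym.
have [/andP[t1 tN] tmin] := tstar_argmin.
case: tstar t1 tN tmin {tstar_argmin} => // t _ tN tmin.
have [l [v [res v0 compl]]] := sweep_residual Csym (U_rbr _ tN).
exists l, v => Lambda V; split=> // [|i]; last first.
  by case: (rbr_feasible U0_feasible U_rbr tN i).
have step := rbr_min_step U0_feasible U_rbr sigma_gt0 N_ge1 tmin.
rewrite res.
have bound : normF (2 *: (strict_upper C *m (U t.+1 - U t)) - sigma *: (U t.+1 - U t)) ^+ 2
    <= 4 * (2 * norm1 C * (4 * normF C ^+ 2 + sigma ^+ 2) / (N%:R * sigma)).
  apply: (le_trans (sqr_normF_residual _ _ _)).
  have -> : normF (U t.+1 - U t) ^+ 2 = normF (U t - U t.+1) ^+ 2.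
    by rewrite -opprB -scaleN1r sqr_normFZ sqrrN expr1n mul1r.
  have c0 : 0 <= 2 * (4 * normF C ^+ 2 + sigma ^+ 2).
    by rewrite mulr_ge0 // addr_ge0 ?sqr_ge0 // mulr_ge0 ?sqr_ge0.
  have := ler_wpM2l c0 step; rewrite /=; lra.
set B := _ / _ in bound *; set X := _ - _ in bound *.
have B0 : 0 <= B by have := le_trans (sqr_ge0 _) bound; lra.
rewrite -(ler_pXn2r (n := 2)) ?nnegrE ?sqrtr_ge0 ?mulr_ge0 ?sqrtr_ge0 //.
rewrite exprMn (sqr_sqrtr B0); apply: le_trans bound _; rewrite expr2; lra.
Qed.
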